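(* Let $(M,\varphi_a,\xi_a,\eta^a,g)_{a=1,2,3}$ be a mixed 3-Sasakian manifold of dimension $4n+3$. Then $M$ is Einstein. More precisely, for any $X,Y\in\Gamma(TM)$, $$\rho(X,Y)=-\sigma(4n+2)\,g(X,Y),$$ where $\rho$ is the Ricci tensor of $g$ and $\sigma=+1$ if the mixed metric 3-structure is positive, $\sigma=-1$ if it is negative.
   Context: All manifolds and tensor fields are smooth. A metric tensor is a symmetric non-degenerate $(0,2)$-tensor field (semi-Riemannian). Conventions: for a 1-form, $2d\eta(X,Y)=X(\eta(Y))-Y(\eta(X))-\eta([X,Y])$; the Nijenhuis tensor of a $(1,1)$-tensor field $\varphi$ is $N_\varphi(X,Y)=\varphi^2[X,Y]+[\varphi X,\varphi Y]-\varphi[\varphi X,Y]-\varphi[X,\varphi Y]$. A triple $(\varphi,\xi,\eta)$ of a $(1,1)$-tensor field, a vector field and a 1-form is an almost paracontact structure if $\varphi^2=I-\eta\otimes\xi$, $\eta(\xi)=1$, and an almost contact structure if $\varphi^2=-I+\eta\otimes\xi$, $\eta(\xi)=1$. It is normal if $N_\varphi=2d\eta\otimes\xi$ in the paracontact case, and if $N_\varphi=-2d\eta\otimes\xi$ in the contact case. Put $\tau_1=\tau_2=-1$, $\tau_3=+1$. A mixed 3-structure on $M$ is a triple of structures $(\varphi_a,\xi_a,\eta^a)$, $a\in\{1,2,3\}$, almost paracontact for $a=1,2$ and almost contact for $a=3$, such that for any cyclic permutation $(a,b,c)$ of $(1,2,3)$: $\varphi_a\varphi_b-\tau_a\eta^b\otimes\xi_a=\tau_c\varphi_c=-\varphi_b\varphi_a+\tau_b\eta^a\otimes\xi_b$;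 $\eta^a\circ\varphi_b=\tau_c\eta^c=-\eta^b\circ\varphi_a$; $\varphi_a(\xi_b)=\tau_b\xi_c$, $\varphi_b(\xi_a)=-\tau_a\xi_c$. If $g$ is a metric tensor on $M$ with $g(\varphi_aX,\varphi_aY)=\tau_a(g(X,Y)-\varepsilon_a\eta^a(X)\eta^a(Y))$ for all $a$ and all $X,Y\in\Gamma(TM)$, where $\varepsilon_a=g(\xi_a,\xi_a)=\pm1$, then $(\varphi_a,\xi_a,\eta^a,g)$ is a mixed metric 3-structure. Necessarily $\varepsilon_1=\varepsilon_2=-\varepsilon_3$; the structure is called positive if $\varepsilon_1=\varepsilon_2=+1$ and negative if $\varepsilon_1=\varepsilon_2=-1$. A mixed metric 3-structure is mixed 3-Sasakian if $(\varphi_1,\xi_1,\eta^1,g)$ and $(\varphi_2,\xi_2,\eta^2,g)$ are paraSasakian and $(\varphi_3,\xi_3,\eta^3,g)$ is indefinite Sasakian, i.e. for each $a$ the structure is normal and $d\eta^a=\Phi_a$, where $\Phi_a(X,Y):=g(X,\varphi_aY)$. Equivalently, with $\nabla$ the Levi-Civita connection, $(\nabla_X\varphi_a)(Y)=\tau_a(g(X,Y)\xi_a-\varepsilon_a\eta^a(Y)X)$ for all $X,Y$ and all $a\in\{1,2,3\}$. Curvature conventions: $R(X,Y)Z=\nabla_X\nabla_YZ-\nabla_Y\nabla_XZ-\nabla_{[X,Y]}Z$, and $\rho(X,Y)=\sum_i\varepsilon_i\, g(R(E_i,X)Y,E_i)$ for a local orthonormal frame $(E_i)$ with $\varepsilon_i=g(E_i,E_i)$.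 *)

(* Defs.v *)
From HB Require Import structures.
From mathcomp Require Import all_boot all_order all_algebra.
From mathcomp Require Import all_classical all_reals.
From mathcomp Require Import ring.
From mathcomp Require Import topology normedtype landau derive.
Import Order.TTheory GRing.Theory Num.Theory numFieldNormedType.Exports.

Set Implicit Arguments.
Unset Strict Implicit.
Unset Printing Implicit Defensive.

Local Open Scope classical_set_scope.
Local Open Scope ring_scope.

(* On an open set U, f is of class C^(k+1) iff it is Frechet differentiable at
   every point of U and all its directional derivatives are of class C^k on U.
   The predicates below are only meaningful (and only used) for open U. *)
Fixpoint class_C {R : realType} {V W : normedModType R} (k : nat)
    (U : set V) (f : V -> W) : Prop :=
  match k with
  | 0 => forall x, U x -> {for x, continuous f}
  | k'.+1 => (forall x, U x -> differentiable f x) /\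
             (forall v, class_C k' U ('D_v f))
  end.

Definition smooth_on {R : realType} {V W : normedModType R}
    (U : set V) (f : V -> W) : Prop := forall k, class_C k U f.

Section class_C_theory.
Context {R : realType} {V W : normedModType R}.
Implicit Types (U : set V).

Lemma near_eq_differentiable (f g : V -> W) x :
  {near x, f =1 g} -> differentiable f x -> differentiable g x.
Proof.
move=> fg df.
suff d0 : differentiable (g - f) x.
  by rewrite -(subrK f g); exact: differentiableD.
have e0 : (g - f) x = 0 by rewrite !fctE (nbhs_singleton fg) subrr.
have oH : (g - f) \o shift x = cst ((g - f) x) + (\0 : V -> W) +o_ 0 id.
  rewrite e0; apply/eqaddoP => e e_gt0.
  have fg0 : \forall y \near (0 : V), f (y + x) = g (y + x).
    by have /nbhs0P := fg; apply: filterS => y; rewrite addrC.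
  near=> y; rewrite !fctE /=.
  suff -> : f (y + x) = g (y + x) by rewrite subrr !addr0 subr0 normr0 mulr_ge0 // ltW.
  by near: y.
have c0 : continuous (\0 : V -> W) by move=> y; exact: cvg_cst.
apply/diff_locallyP; rewrite (diff_unique c0 oH); split => //.
Unshelve. all: by end_near. Qed.

Lemma class_C_ext k U (f g : V -> W) : open U ->
  (forall x, U x -> f x = g x) -> class_C k U f -> class_C k U g.
Proof.
move=> oU; elim: k f g => [|k IH] f g fg /=.
  move=> cf x Ux.
  have nfg : {near x, f =1 g}.
    by have := open_nbhs_nbhs (conj oU Ux); apply: filterS => y /fg.
  have cfx : f @ x --> f x := cf _ Ux.
  suff : g @ x --> g x by [].
  rewrite -(fg _ Ux); apply: cvg_trans cfx; apply: near_eq_cvg; exact: nfg.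
move=> [df Df].
have nfg x : U x -> {near x, f =1 g}.
  by move=> Ux; have := open_nbhs_nbhs (conj oU Ux); apply: filterS => y /fg.
split=> [x Ux|v]; first exact: near_eq_differentiable (nfg _ Ux) (df _ Ux).
apply: IH (Df v) => x Ux; exact: near_eq_derive (nfg _ Ux).
Qed.

Lemma class_CS k U (f : V -> W) : class_C k.+1 U f -> class_C k U f.
Proof.
elim: k f => [|k IH] f [df Df].
  by move=> x Ux; exact: differentiable_continuous (df _ Ux).
by split => // v; apply: IH; exact: Df.
Qed.

Lemma class_C_cst k U (a : W) : open U -> class_C k U (cst a).
Proof.
move=> oU; elim: k a => [|k IH] a /=; first by move=> x _; exact: cvg_cst.
split=> [x _|v]; first exact: differentiable_cst.
by apply: class_C_ext (IH 0) => // x Ux; rewrite derive_cst.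
Qed.

Lemma class_CD k U (f g : V -> W) : open U ->
  class_C k U f -> class_C k U g -> class_C k U (f + g).
Proof.
move=> oU; elim: k f g => [|k IH] f g /=.
  by move=> cf cg x Ux; apply: cvgD; [exact: cf|exact: cg].
move=> [df Df] [dg Dg]; split=> [x Ux|v].
  by apply: differentiableD; [exact: df|exact: dg].
apply: class_C_ext (IH _ _ (Df v) (Dg v)) => // x Ux.
by rewrite deriveD //; apply: diff_derivable; [exact: df|exact: dg].
Qed.

Lemma class_CZ k U (a : R) (f : V -> W) : open U ->
  class_C k U f -> class_C k U (a *: f).
Proof.
move=> oU; elim: k f => [|k IH] f /=.
  by move=> cf x Ux; apply: cvgZr; exact: cf.
move=> [df Df]; split=> [x Ux|v]; first by apply: differentiableZ; exact: df.
apply: class_C_ext (IH _ (Df v)) => // x Ux.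
by rewrite deriveZ //; apply: diff_derivable; exact: df.
Qed.

End class_C_theory.

Lemma class_CM {R : realType} {V : normedModType R} k (U : set V)
    (f g : V -> R) : open U ->
  class_C k U f -> class_C k U g -> class_C k U (f * g).
Proof.
move=> oU; elim: k f g => [|k IH] f g.
  by move=> cf cg x Ux; apply: cvgM; [exact: cf|exact: cg].
move=> cf cg; have [[df Df] [dg Dg]] := (cf, cg); split=> [x Ux|v].
  by apply: differentiableM; [exact: df|exact: dg].
apply: class_C_ext (class_CD oU (IH _ _ (class_CS cf) (Dg v))
                                (IH _ _ (class_CS cg) (Df v))) => // x Ux.
by rewrite deriveM //; apply: diff_derivable; [exact: df|exact: dg].
Qed.

Record chart (R : realType) (T : topologicalType) (m : nat) := Chart {
  chart_dom : set T ;
  chart_cod : set 'rV[R]_m ;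
  chart_map : T -> 'rV[R]_m ;
  chart_inv : 'rV[R]_m -> T ;
  chart_dom_open : open chart_dom ;
  chart_cod_open : open chart_cod ;
  chart_map_cod : forall p, chart_dom p -> chart_cod (chart_map p) ;
  chart_inv_dom : forall x, chart_cod x -> chart_dom (chart_inv x) ;
  chart_mapK : forall p, chart_dom p -> chart_inv (chart_map p) = p ;
  chart_invK : forall x, chart_cod x -> chart_map (chart_inv x) = x ;
  chart_map_continuous : forall p, chart_dom p -> {for p, continuous chart_map} ;
  chart_inv_continuous : forall x, chart_cod x -> {for x, continuous chart_inv}
}.

Arguments chart_dom_open {R T m} c : rename.
Arguments chart_cod_open {R T m} c : rename.

(* A smooth manifold of dimension m without boundary, given by a (not
   necessarily maximal) smooth atlas. *)
Record smoothManifold (R : realType) (m : nat) := SmoothManifold {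
  manifold_sort :> topologicalType ;
  atlas : set (chart R manifold_sort m) ;
  manifold_hausdorff : hausdorff_space manifold_sort ;
  manifold_second_countable : @second_countable manifold_sort ;
  atlas_cover : forall p : manifold_sort, exists2 c, atlas c & chart_dom c p ;
  atlas_compatible : forall c c', atlas c -> atlas c' ->
    smooth_on (chart_cod c `&` chart_inv c @^-1` chart_dom c')
              (chart_map c' \o chart_inv c)
}.

Section smooth_functions.
Context {R : realType} {m : nat} (M : smoothManifold R m).

Definition smooth (f : M -> R) : Prop :=
  forall c, atlas c -> smooth_on (chart_cod c) (f \o chart_inv c).

Definition smooth_pred : {pred M -> R} := fun f => `[< smooth f >].

(* C^oo(M), as a commutative ring (trivial when M is empty) and R-module. *)
Record smoothFun := SmoothFun {
  smoothFun_val :> M -> R ;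
  smoothFun_valP : smoothFun_val \in smooth_pred
}.

HB.instance Definition _ := [isSub for smoothFun_val].
HB.instance Definition _ := [Choice of smoothFun by <:].

Lemma smooth_subring_closed : subring_closed smooth_pred.
Proof.
split=> [|f g|f g]; rewrite -!topredE /=.
- by apply/asboolP => c _ k; apply: class_C_cst; exact: chart_cod_open.
- move=> /asboolP sf /asboolP sg; apply/asboolP => c ac k.
  have oc := chart_cod_open c; rewrite -scaleN1r.
  by apply: class_CD => //; [exact: sf|apply: class_CZ => //; exact: sg].
- move=> /asboolP sf /asboolP sg; apply/asboolP => c ac k.
  by apply: class_CM; [exact: chart_cod_open|exact: sf|exact: sg].
Qed.

HB.instance Definition _ :=
  GRing.isSubringClosed.Build _ smooth_pred smooth_subring_closed.

Lemma smooth_scaler_closed : GRing.scaler_closed smooth_pred.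
Proof.
move=> a f; rewrite -!topredE /= => /asboolP sf; apply/asboolP => c ac k.
by apply: class_CZ; [exact: chart_cod_open|exact: sf].
Qed.

HB.instance Definition _ :=
  GRing.isScaleClosed.Build _ _ smooth_pred smooth_scaler_closed.
HB.instance Definition _ := GRing.SubChoice_isSubComPzRing.Build
  (M -> R) smooth_pred smoothFun smooth_subring_closed.
HB.instance Definition _ := [SubZmodule_isSubLmodule of smoothFun by <:].

Lemma smoothFun_scalerAl (a : R) (f h : smoothFun) : a *: (f * h) = a *: f * h.
Proof. by apply/val_inj/funext => p /=; exact: mulrA. Qed.

Lemma smoothFun_scalerAr (a : R) (f h : smoothFun) : a *: (f * h) = f * (a *: h).
Proof. by rewrite mulrC smoothFun_scalerAl mulrC. Qed.

End smooth_functions.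

Section vector_fields.
Context {R : realType} {m : nat} (M : smoothManifold R m).

Definition derivation (D : smoothFun M -> smoothFun M) : Prop :=
  linear D /\ forall f h, D (f * h) = D f * h + f * D h.

Definition derivation_pred : {pred smoothFun M -> smoothFun M} :=
  fun D => `[< derivation D >].

(* Gamma(TM): smooth vector fields on M are identified with the R-linear
   derivations of C^oo(M). *)
Record vfield := VField {
  vfield_val :> smoothFun M -> smoothFun M ;
  vfield_valP : vfield_val \in derivation_pred
}.

HB.instance Definition _ := [isSub for vfield_val].
HB.instance Definition _ := [Choice of vfield by <:].

Lemma vfieldP (X : vfield) : derivation X.
Proof. exact/asboolP/(vfield_valP X). Qed.

Lemma vfield_eqP (X Y : vfield) : X = Y <-> X =1 Y.
Proof. by split=> [->//|XY]; apply/val_inj/funext. Qed.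

Lemma derivation_zmod_closed : zmod_closed derivation_pred.
Proof.
split=> [|D E]; rewrite -!topredE /=.
  have zE u : (0 : smoothFun M -> smoothFun M) u = 0 by [].
  apply/asboolP; split=> [a f h|f h]; rewrite !zE.
    by rewrite scaler0 addr0.
  by rewrite mul0r mulr0 addr0.
have bE u : (D - E) u = D u - E u by [].
move=> /asboolP [lD DM] /asboolP [lE EM].
apply/asboolP; split=> [a f h|f h]; rewrite !bE.
  by rewrite lD lE scalerBr opprD addrACA.
by rewrite DM EM mulrBl mulrBr opprD addrACA.
Qed.

HB.instance Definition _ := GRing.SubChoice_isSubZmodule.Build
  (smoothFun M -> smoothFun M) derivation_pred vfield derivation_zmod_closed.

Fact vfield_scale_subproof (f : smoothFun M) (X : vfield) :
  (fun h => f * X h) \in derivation_pred.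
Proof.
have [lX XM] := vfieldP X.
rewrite -topredE /=; apply/asboolP; split=> [a u v|u v] /=.
  by rewrite lX mulrDr smoothFun_scalerAr.
by rewrite XM mulrDr mulrA !mulrA (mulrC u).
Qed.

Definition vfield_scale f X : vfield := VField (vfield_scale_subproof f X).

Fact vfield_scalerA f h X :
  vfield_scale f (vfield_scale h X) = vfield_scale (f * h) X.
Proof. by apply/vfield_eqP => u /=; rewrite mulrA. Qed.

Fact vfield_scale1r : left_id 1 vfield_scale.
Proof. by move=> X; apply/vfield_eqP => u /=; rewrite mul1r. Qed.

Fact vfield_scalerDr : right_distributive vfield_scale +%R.
Proof. by move=> f X Y; apply/vfield_eqP => u /=; rewrite -mulrDr. Qed.

Fact vfield_scalerDl X : {morph vfield_scale^~ X : f h / f + h}.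
Proof. by move=> f h; apply/vfield_eqP => u /=; rewrite mulrDl. Qed.

HB.instance Definition _ := GRing.Zmodule_isLmodule.Build (smoothFun M) vfield
  vfield_scalerA vfield_scale1r vfield_scalerDr vfield_scalerDl.

Fact lie_subproof (X Y : vfield) :
  (fun f => X (Y f) - Y (X f)) \in derivation_pred.
Proof.
have [lX XM] := vfieldP X; have [lY YM] := vfieldP Y.
have aX f h : X (f + h) = X f + X h.
  by rewrite -[f in LHS]scale1r lX scale1r.
have aY f h : Y (f + h) = Y f + Y h.
  by rewrite -[f in LHS]scale1r lY scale1r.
rewrite -topredE /=; apply/asboolP; split=> [a f h|f h] /=.
  by rewrite !lX !lY !lX scalerBr opprD addrACA.
rewrite YM XM aX aY !XM !YM; ring.
Qed.

Definition lie (X Y : vfield) : vfield := VField (lie_subproof X Y).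

End vector_fields.

Section geometry.
Context {R : realType} {m : nat} {M : smoothManifold R m}.
Implicit Types (X Y Z : vfield M) (p : M).

(* A (0,2)-tensor field is a C^oo(M)-bilinear map on Gamma(TM). In the pointwise
   non-degeneracy condition, T_pM is the set of values at p of vector fields:
   X vanishes at p iff (X f)(p) = 0 for every smooth f. *)
Record metric := Metric {
  metric_val :> vfield M -> vfield M -> smoothFun M ;
  metric_linearl : forall f X Y Z,
    metric_val (f *: X + Y) Z = f * metric_val X Z + metric_val Y Z ;
  metric_sym : forall X Y, metric_val X Y = metric_val Y X ;
  metric_nondegenerate : forall p X, (forall Y, metric_val X Y p = 0) ->
    forall f, X f p = 0
}.

Record levi_civita (g : metric) (nabla : vfield M -> vfield M -> vfield M)
    : Prop := LeviCivita {
  connection_linearl : forall f X Y Z,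
    nabla (f *: X + Y) Z = f *: nabla X Z + nabla Y Z ;
  connection_additive : forall X Y Z, nabla X (Y + Z) = nabla X Y + nabla X Z ;
  connection_leibniz : forall f X Y,
    nabla X (f *: Y) = X f *: Y + f *: nabla X Y ;
  connection_torsion_free : forall X Y, nabla X Y - nabla Y X = lie X Y ;
  connection_metric : forall X Y Z,
    X (g Y Z) = g (nabla X Y) Z + g Y (nabla X Z)
}.

Definition riemann (nabla : vfield M -> vfield M -> vfield M) X Y Z : vfield M :=
  nabla X (nabla Y Z) - nabla Y (nabla X Z) - nabla (lie X Y) Z.

(* The restrictions of the E i to a neighbourhood of p form an orthonormal
   frame. Every local frame around p is of this form, after shrinking its
   domain, by means of a bump function. *)
Definition local_orthonormal_frame (g : metric) p (E : 'I_m -> vfield M) : Prop :=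
  \forall q \near p,
    [/\ forall X, exists! c : 'I_m -> R,
          forall f, X f q = \sum_(i < m) c i * E i f q,
        forall i, g (E i) (E i) q = 1 \/ g (E i) (E i) q = -1
      & forall i j, i != j -> g (E i) (E j) q = 0].

(* The trace does not depend on the frame; such frames exist around every p. *)
Definition is_ricci (g : metric) (nabla : vfield M -> vfield M -> vfield M)
    (rho : vfield M -> vfield M -> smoothFun M) : Prop :=
  forall p, exists2 E : 'I_m -> vfield M, local_orthonormal_frame g p E &
    forall X Y, rho X Y p =
      \sum_(i < m) g (E i) (E i) p * g (riemann nabla (E i) X Y) (E i) p.

Definition einstein (g : metric) (rho : vfield M -> vfield M -> smoothFun M) :
  Prop := exists lambda : R, forall X Y, rho X Y = lambda *: g X Y.

Definition ext_deriv (eta : {scalar vfield M}) X Y : smoothFun M :=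
  2^-1 *: (X (eta Y) - Y (eta X) - eta (lie X Y)).

Definition nijenhuis (phi : {linear vfield M -> vfield M}) X Y : vfield M :=
  phi (phi (lie X Y)) + lie (phi X) (phi Y)
  - phi (lie (phi X) Y) - phi (lie X (phi Y)).

Record structure := Structure {
  phi : {linear vfield M -> vfield M} ;
  xi : vfield M ;
  eta : {scalar vfield M}
}.

Definition almost_paracontact (s : structure) : Prop :=
  (forall X, phi s (phi s X) = X - eta s X *: xi s) /\ eta s (xi s) = 1.

Definition almost_contact (s : structure) : Prop :=
  (forall X, phi s (phi s X) = - X + eta s X *: xi s) /\ eta s (xi s) = 1.

Definition normal_paracontact (s : structure) : Prop :=
  forall X Y, nijenhuis (phi s) X Y = (2 *: ext_deriv (eta s) X Y) *: xi s.

Definition normal_contact (s : structure) : Prop :=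
  forall X Y, nijenhuis (phi s) X Y = - ((2 *: ext_deriv (eta s) X Y) *: xi s).

Definition compatible (g : metric) (tau eps : int) (s : structure) : Prop :=
  [/\ eps = 1 \/ eps = -1,
      g (xi s) (xi s) = eps%:~R
    & forall X Y, g (phi s X) (phi s Y) =
        (g X Y - eps%:~R * (eta s X * eta s Y)) *~ tau].

Definition fundamental_form (g : metric) (s : structure) X Y : smoothFun M :=
  g X (phi s Y).

Definition paraSasakian (g : metric) (eps : int) (s : structure) : Prop :=
  [/\ almost_paracontact s, compatible g (-1) eps s, normal_paracontact s
    & forall X Y, ext_deriv (eta s) X Y = fundamental_form g s X Y].

Definition indefinite_sasakian (g : metric) (eps : int) (s : structure) : Prop :=
  [/\ almost_contact s, compatible g 1 eps s, normal_contact s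
    & forall X Y, ext_deriv (eta s) X Y = fundamental_form g s X Y].

(* The indices 1, 2, 3 are the elements 0, 1, 2 of 'I_3, so that the cyclic
   permutations of (1,2,3) are the triples (a, ordS a, ordS (ordS a)). *)
Definition tau (a : 'I_3) : int := if a == ord_max then 1 else -1.

Definition mixed_3_structure (S : 'I_3 -> structure) : Prop :=
  (forall a, if a == ord_max then almost_contact (S a)
             else almost_paracontact (S a)) /\
  forall a, let b := ordS a in let c := ordS b in
    [/\ forall X, phi (S a) (phi (S b) X) - (eta (S b) X *: xi (S a)) *~ tau a
          = phi (S c) X *~ tau c,
        forall X, phi (S c) X *~ tau c
          = - phi (S b) (phi (S a) X) + (eta (S a) X *: xi (S b)) *~ tau b,
        forall X, eta (S a) (phi (S b) X) = eta (S c) X *~ tau c,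
        forall X, eta (S c) X *~ tau c = - eta (S b) (phi (S a) X)
      & phi (S a) (xi (S b)) = xi (S c) *~ tau b /\
        phi (S b) (xi (S a)) = - (xi (S c) *~ tau a)].

Definition mixed_metric_3_structure (g : metric) (eps : 'I_3 -> int)
    (S : 'I_3 -> structure) : Prop :=
  mixed_3_structure S /\ forall a, compatible g (tau a) (eps a) (S a).

Definition mixed_3_sasakian (g : metric) (eps : 'I_3 -> int)
    (S : 'I_3 -> structure) : Prop :=
  mixed_metric_3_structure g eps S /\
  forall a, if a == ord_max then indefinite_sasakian g (eps a) (S a)
            else paraSasakian g (eps a) (S a).

End geometry.

Arguments metric {R m} M.
Arguments structure {R m} M.

Definition positive (eps : 'I_3 -> int) : Prop := eps 0 = 1 /\ eps 1 = 1.
Definition negative (eps : 'I_3 -> int) : Prop := eps 0 = -1 /\ eps 1 = -1.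

(* Main.v *)
From HB Require Import structures.
Require Import Defs.
From mathcomp Require Import all_boot all_order all_algebra.
From mathcomp Require Import all_classical all_reals.
From mathcomp Require Import ring lra.
From mathcomp Require Import topology normedtype landau derive.
From mathcomp Require Import sequences exp realfun.
Import Order.TTheory GRing.Theory Num.Theory numFieldNormedType.Exports.

(** Write [e] for the common value of [g xi_1 xi_1] and [g xi_2 xi_2], where
    [(phi_1, xi_1, eta_1)] and [(phi_2, xi_2, eta_2)] are the two paraSasakian
    structures (of index [0] and [1] in the code), and set

      [W(X, Y, Z, V) = g(R(X, Y) Z, V) + e (g(Y, Z) g(X, V) - g(X, Z) g(Y, V))].

    This is the difference between the curvature of [g] and the curvature of a
    space of constant curvature [- e], so [g] is Einstein with constant
    [- e (dim M - 1) = - e (4 n + 2)] as soon as [W] has zero Ricci trace.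

    A paraSasakian structure satisfies
    [(nabla_X phi) Y = e eta(Y) X - g(X, Y) xi] and [nabla_X xi = - e phi X]
    (lemmas [nabla_phi] and [nabla_xi]). Differentiating once more shows that the
    commutator of [R(X, Y)] with [phi] is the one of the constant curvature
    model, that is, [W(X, Y)] commutes with [phi] (lemma [curv_dev_phi]), and
    then [W] kills [xi]. Hence [W] behaves as the curvature of a hyperkaehler
    metric, and the classical argument for the vanishing of the Ricci tensor of
    such a metric applies. As [phi_2] commutes with [W(X, Y)] and anticommutes
    with [phi_1] up to terms in [xi_1] and [xi_2], the trace of
    [phi_1 o W(X, Y)] equals its opposite, so it is zero ([trace_phi_curv_dev]).
    Together with the first Bianchi identity this makes [Ric_W(X, phi_1 Y)]
    symmetric in [X] and [Y], while the pair symmetry of [W] makes it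
    antisymmetric. So [Ric_W(X, phi_1 Y) = 0], and since [phi_1 (phi_1 Y)] is [Y]
    up to a multiple of [xi_1], also [Ric_W(X, Y) = 0] ([ricci_curv_dev0]).

    The traces are sums over a local orthonormal frame, whereas tensor fields are
    maps on global vector fields that are linear over the smooth functions. To
    pass from one to the other one needs that a linear form over the smooth
    functions depends, at a point, only on the value of its argument at that
    point ([one_form_pointwise]); this rests on the existence of smooth bump
    functions on a manifold ([bump_function]), obtained from [exp(- 1 / x)]. *)

Set Implicit Arguments.
Unset Strict Implicit.
Unset Printing Implicit Defensive.

Local Open Scope classical_set_scope.
Local Open Scope ring_scope.


(** * Smooth bump functions *)

Lemma near_class_C {R : realType} {V W : normedModType R} k (U : set V)
    (f : V -> W) :
  (forall x, U x -> exists A, [/\ open A, A x & class_C k A f]) ->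
  class_C k U f.
Proof.
elim: k U f => [|k IH] U f H /=.
  by move=> x /H [A [_ Ax cA]]; exact: (cA x Ax).
split=> [x /H [A [_ Ax [dA _]]]|v]; first exact: dA.
apply: IH => x /H [A [oA Ax [_ DA]]].
by exists A; split=> //; exact: DA.
Qed.

(** The whole family is needed for an induction on the order of
    differentiability: the derivative of [flat n] is a linear combination of
    [flat n.+1] and [flat n.+2]. *)
Definition flat {R : realType} (n : nat) (x : R) : R :=
  if 0 < x then x ^- n * expR (- x^-1) else 0.

Lemma flat_gt0 {R : realType} n (x : R) : 0 < x -> 0 < flat n x.
Proof.
by move=> x0; rewrite /flat x0 mulr_gt0 ?expR_gt0 ?invr_gt0 ?exprn_gt0.
Qed.

Lemma flat_le0 {R : realType} n (x : R) : x <= 0 -> flat n x = 0.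
Proof. by rewrite /flat ltNge => ->. Qed.

Lemma flat_ge0 {R : realType} n (x : R) : 0 <= flat n x.
Proof. by have [/flat_le0 ->//|/(flat_gt0 n)/ltW] := leP x 0. Qed.

(** From [expR y >= y ^ (n + 2) / (n + 2)!] at [y = x^-1]; it says that
    [flat n] vanishes to second order at [0], hence has derivative [0] there.
    *)
Lemma flat_le_sqr {R : realType} n (x : R) : flat n x <= (n.+2)`!%:R * x ^+ 2.
Proof.
have [x0|x0] := leP x 0; first by rewrite flat_le0// mulr_ge0 ?sqr_ge0.
rewrite /flat x0 expRN.
have f0 : 0 < (n.+2)`!%:R :> R by rewrite ltr0n fact_gt0.
have h : x^-1 ^+ n.+2 / (n.+2)`!%:R <= expR x^-1.
  apply: le_trans (expR_ge1Dxn n.+1 _); last by rewrite invr_ge0 ltW.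
  by rewrite lerDr.
have h0 : 0 < x^-1 ^+ n.+2 / (n.+2)`!%:R.
  by rewrite divr_gt0// exprn_gt0// invr_gt0.
have -> : (n.+2)`!%:R * x ^+ 2 = x ^- n * (x^-1 ^+ n.+2 / (n.+2)`!%:R)^-1.
  rewrite invf_div exprVn invrK -(addn2 n) exprD.
  by field; rewrite ?gt_eqF ?exprn_gt0//.
rewrite ler_pM2l ?invr_gt0 ?exprn_gt0//.
by rewrite lef_pV2 // posrE ?expR_gt0.
Qed.

Lemma is_derive_flat_gt0 {R : realType} n (x : R) : 0 < x ->
  is_derive x 1 (flat n) (flat n.+2 x - n%:R * flat n.+1 x).
Proof.
move=> x0; have xN0 : x != 0 by rewrite gt_eqF.
apply: (@near_eq_is_derive _ _ _
  (((fun y => y^-1) ^+ n) * (expR \o (fun y => - y^-1)))).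
  have := lt_nbhsr x0; apply: filterS => y y0.
  rewrite /flat y0 -exprVn; congr (_ * _).
  by elim: n => // n IH; rewrite !exprS -IH.
have dV : is_derive x 1 (fun y : R => y^-1) (- x ^- 2).
  by have := @is_deriveV _ id x 1 1 xN0 (is_derive_id _ _); rewrite /= scaler1.
have dE : is_derive x 1 (expR \o (fun y : R => - y^-1))
    (expR (- x^-1) * x ^- 2).
  apply: is_derive1_comp.
  by rewrite -[x ^- 2]opprK; exact: is_deriveN.
have := is_deriveM (is_deriveX n dV) dE.
have -> : ((fun y : R => y^-1) ^+ n) x = x ^- n.
  by rewrite -exprVn; elim: n => // n IH; rewrite !exprS -IH.
rewrite /flat x0.
congr is_derive.
rewrite /= /GRing.scale /= -!exprVn.
case: n => [|n]; first by rewrite !expr0 !mul0r mulr0 expr2; ring.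
rewrite !exprS /=; ring.
Qed.

Lemma is_derive_flat_0 {R : realType} n : is_derive (0 : R) 1 (flat n) 0.
Proof.
suff c0 : (fun h : R =>
    h^-1 *: ((flat n \o shift 0) (h *: 1) - flat n 0)) @ 0^' --> (0 : R).
  by apply: DeriveDef; [apply/cvg_ex; exists 0|apply/cvg_lim].
apply: (@cvg_to_0_linear _ _ (n.+2)`!%:R 1) => // h /andP[h0 _].
rewrite /= (flat_le0 _ (lexx 0)) subr0 addr0 /GRing.scale /= mulr1.
rewrite normrM normfV (ger0_norm (flat_ge0 _ _)) ler_pdivrMl//.
by rewrite mulrCA -expr2 real_normK ?num_real// flat_le_sqr.
Qed.

Lemma is_derive_flat {R : realType} n (x : R) :
  is_derive x 1 (flat n) (flat n.+2 x - n%:R * flat n.+1 x).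
Proof.
have [x0|x0|->] := ltgtP x 0; last first.
- by rewrite !flat_le0// mulr0 subr0; exact: is_derive_flat_0.
- exact: is_derive_flat_gt0.
- apply: (@near_eq_is_derive _ _ _ (cst 0)).
    by have := lt_nbhsl x0; apply: filterS => y y0; rewrite flat_le0 ?ltW.
  by rewrite !flat_le0 ?ltW// mulr0 subr0; exact: is_derive_cst.
Qed.

Lemma differentiable_flat {R : realType} n (x : R) : differentiable (flat n) x.
Proof. by apply/derivable1_diffP; case: (is_derive_flat n x). Qed.

(** Differentiating lowers the order by one and keeps the shape [flat _ \o u],
    by the chain rule, so the induction must be on all [n] at once. *)
Lemma class_C_flat_comp {R : realType} {V : normedModType R} k n (U : set V)
  (u : V -> R) : open U -> class_C k U u -> class_C k U (flat n \o u).
Proof.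
move=> oU; elim: k n => [|k IH] n cu.
  move=> x Ux; apply: (@continuous_comp _ _ _ u (flat n)).
    exact: (cu x Ux).
  exact/differentiable_continuous/differentiable_flat.
have [du Du] := cu; split=> [x Ux|v].
  by apply: differentiable_comp; [exact: du|exact: differentiable_flat].
have cu' := class_CS cu.
apply: (class_C_ext oU _ (class_CM oU (class_CD oU (IH n.+2 cu')
  (class_CZ (- n%:R) oU (IH n.+1 cu'))) (Du v))) => x Ux.
have dux := du x Ux.
rewrite [RHS]deriveE; last first.
  by apply: differentiable_comp => //; exact: differentiable_flat.
rewrite diff_comp//; last exact: differentiable_flat.
rewrite /= diff1E; last exact: differentiable_flat.
rewrite -deriveE// derive1E.
rewrite (@derive_val _ _ _ _ _ _ _ (is_derive_flat n (u x))).
rewrite /GRing.scale /= mulrC; congr (_ * _).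
by rewrite !fctE /= /GRing.scale /= mulNr.
Qed.

Lemma class_C_sum {R : realType} {V W : normedModType R} k (U : set V)
  (I : Type) (s : seq I) (F : I -> V -> W) : open U ->
  (forall i, class_C k U (F i)) -> class_C k U (\sum_(i <- s) F i).
Proof.
move=> oU cF; elim/big_rec: _ => [|i f _ cf]; first exact: (class_C_cst k 0 oU).
exact: class_CD.
Qed.

Lemma class_C_coord {R : realType} {V : normedModType R} {m} k (U : set V)
  (f : V -> 'rV[R]_m) j : open U -> class_C k U f ->
  class_C k U (fun x => f x ord0 j).
Proof.
move=> oU; elim: k f => [|k IH] f.
  move=> cf x Ux.
  apply: (@continuous_comp _ _ _ f (fun y : 'rV[R]_m => y ord0 j)).
    exact: (cf x Ux).
  exact: coord_continuous.
move=> [df Df]; split=> [x Ux|v].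
  apply: (@differentiable_comp _ _ _ _ f (fun y : 'rV[R]_m => y ord0 j)).
    exact: df.
  exact: differentiable_coord.
apply: class_C_ext (IH _ (Df v)) => // x Ux.
by rewrite derive_mx; [rewrite mxE|exact/diff_derivable/df].
Qed.

Lemma chart_cod_preimage_open {R : realType} {T : topologicalType} {m}
  (c : chart R T m) (A : set T) : open A ->
  open (chart_cod c `&` chart_inv c @^-1` A).
Proof.
move: A; apply/(continuous_inP _ (chart_cod_open c)) => x.
by rewrite inE => /chart_inv_continuous.
Qed.

(** The Euclidean bump [flat 0 (r^2 - |y - a|^2)] in a chart, extended by [0].
    Its support lies in the image [S] of a compact box, which is closed
    because the manifold is Hausdorff; so every point off the chart domain has
    a neighbourhood where the extension vanishes. *)
Lemma bump_function {R : realType} {m} (M : smoothManifold R m) (p : M)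
  (U : set M) : nbhs p U ->
  exists2 h : smoothFun M, h p != 0 & forall q, ~ U q -> h q = 0.
Proof.
move=> Up; have [c ac cp] := atlas_cover p.
pose a := chart_map c p.
have ca : chart_cod c a := chart_map_cod cp.
have [e /= e0 ballU] : exists2 e : R, 0 < e &
    ball a e `<=` chart_cod c `&` chart_inv c @^-1` U.
  apply/nbhs_ballP/filterI.
    by apply: open_nbhs_nbhs; split => //; exact: chart_cod_open.
  by apply: (chart_inv_continuous ca); rewrite /a chart_mapK.
pose r := e / 2.
have r0 : 0 < r by rewrite divr_gt0.
pose side j : set R := `[a ord0 j - r, a ord0 j + r]%classic.
pose box := [set y : 'rV[R]_m | forall j, side j (y ord0 j)].
have box_ball : box `<=` ball a e.
  move=> y By; split=> // i j; rewrite ord1 /ball /=; have := By j.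
  rewrite /side /= in_itv /= -ler_distlC => h; apply: le_lt_trans h _.
  by rewrite /r ltr_pdivrMr// ltr_pMr// ltr1n.
have cbox : compact box.
  by apply: (@rV_compact R m side) => j; exact: segment_compact.
pose S := chart_inv c @` box.
have clS : closed S.
  apply: compact_closed; first exact: manifold_hausdorff.
  apply: continuous_compact => //.
  apply: continuous_in_subspaceT => y; rewrite inE => /box_ball/ballU[cy _].
  exact: chart_inv_continuous.
pose b (y : 'rV[R]_m) := flat 0 (r ^+ 2 - \sum_j (y ord0 j - a ord0 j) ^+ 2).
have b_box y : ~ box y -> b y = 0.
  move=> nB; apply: flat_le0; rewrite subr_le0 leNgt.
  apply: contra_notN nB => lt j; rewrite /side /= in_itv /= -ler_distlC distrC.
  rewrite -(@ler_pXn2r _ 2) ?nnegrE ?(ltW r0)// real_normK ?num_real//.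
  apply: le_trans (ltW lt); rewrite (bigD1 j)//= lerDl.
  by apply: sumr_ge0 => i _; exact: sqr_ge0.
pose h q := if `[< chart_dom c q >] then b (chart_map c q) else 0.
have hS q : ~ S q -> h q = 0.
  rewrite /h; case: asboolP => // cq nS; apply: b_box => bq; apply: nS.
  by exists (chart_map c q) => //; rewrite chart_mapK.
have sh : h \in @smooth_pred R m M.
  rewrite -topredE /=; apply/asboolP => c' ac' k.
  apply: near_class_C => x c'x.
  have [cq|ncq] := pselect (chart_dom c (chart_inv c' x)).
    pose A := chart_cod c' `&` chart_inv c' @^-1` chart_dom c.
    have oA : open A by apply: chart_cod_preimage_open; exact: chart_dom_open.
    exists A; split => //.
    pose T := chart_map c \o chart_inv c'.
    have cT : class_C k A T by exact: atlas_compatible.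
    pose u y := r ^+ 2 - \sum_j (T y ord0 j - a ord0 j) ^+ 2.
    apply: (@class_C_ext _ _ _ _ _ (flat 0 \o u)) => //.
      by move=> y [_ /= cy]; rewrite /h; case: asboolP.
    apply: class_C_flat_comp => //.
    pose G j := (fun y : 'rV[R]_m => T y ord0 j) + cst (- a ord0 j).
    apply: (@class_C_ext _ _ _ _ _
      (cst (r ^+ 2) + (-1) *: \sum_j (G j * G j))) => //.
      move=> y _; rewrite /u !fctE /= scaleN1r; congr (_ - _).
      by rewrite fct_sumE; apply: eq_bigr => j _; rewrite expr2.
    apply: class_CD => //; first exact: class_C_cst.
    apply: class_CZ => //; apply: class_C_sum => // j.
    have cG : class_C k A (G j).
      apply: class_CD => //; last exact: class_C_cst.
      exact: (@class_C_coord _ _ _ _ _ T).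
    exact: class_CM.
  have nS : ~ S (chart_inv c' x).
    move=> [y /box_ball/ballU[cy _] yx]; apply: ncq.
    by rewrite -yx; exact: chart_inv_dom.
  pose A := chart_cod c' `&` chart_inv c' @^-1` (~` S).
  have oA : open A by apply: chart_cod_preimage_open; exact: closed_openC.
  exists A; split => //.
  apply: (@class_C_ext _ _ _ _ _ (cst 0)) => //; last exact: class_C_cst.
  by move=> y [_ /= /hS].
exists (SmoothFun sh) => /=.
  rewrite /h; case: asboolP => // _.
  rewrite gt_eqF// /b flat_gt0// big1 ?subr0 ?exprn_gt0// => j _.
  by rewrite subrr expr0n.
move=> q nU; apply: hS => -[y /box_ball/ballU[_ /= Uy] yq]; apply: nU.
by rewrite -yq.
Qed.

(** * Linear forms over the smooth functions are pointwise *)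

Lemma smoothFun_continuous {R : realType} {m} {M : smoothManifold R m}
  (f : smoothFun M) : continuous f.
Proof.
move=> p; have [c ac cp] := atlas_cover p.
have /asboolP sf := smoothFun_valP f.
have cf : {for chart_map c p, continuous (f \o chart_inv c)} :=
  sf c ac 0 _ (chart_map_cod cp).
have : {for p, continuous ((f \o chart_inv c) \o chart_map c)}.
  by apply: continuous_comp => //; exact: chart_map_continuous.
rewrite /continuous_at [X in _ --> X -> _]/= chart_mapK// => H.
apply: cvg_trans H; apply: near_eq_cvg.
have := open_nbhs_nbhs (conj (chart_dom_open c) cp).
by apply: filterS => q cq /=; rewrite chart_mapK.
Qed.

(** If the coordinates of a vector valued function are linearly independent,
    some of its values form a basis: as long as fewer than [m] independent
    values [A] have been found, a nonzero column of [cokermx A] is a linear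
    relation that holds for these values, hence fails for some other value. *)
Lemma exists_unitmx_rows {F : fieldType} {V : Type} {m} (e : V -> 'rV[F]_m) :
  (forall c : 'cV_m, (forall v, e v *m c = 0) -> c = 0) ->
  exists v : 'I_m -> V, \matrix_j e (v j) \in unitmx.
Proof.
move=> indep.
suff H k : (k <= m)%N -> exists v : 'I_k -> V, row_free (\matrix_j e (v j)).
  by have [v fv] := H m (leqnn m); exists v; rewrite -row_free_unit.
elim: k => [_|k IH km].
  exists (fun i : 'I_0 => False_rect V (notF (ltn_ord i))).
  by rewrite -row_leq_rank leq0n.
have [vs freeA] := IH (ltnW km); pose A := \matrix_j e (vs j).
have [v ev] : exists v, e v *m cokermx A != 0.
  apply: contrapT => /forallNP H.
  have : cokermx A = 0.
    apply/matrixP => i j.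
    suff /matrixP/(_ i ord0) : col j (cokermx A) = 0 by rewrite !mxE.
    apply: indep => v; have /negP/negPn/eqP ev := H v.
    by rewrite colE mulmxA ev mul0mx.
  move/eqP; rewrite -mxrank_eq0 mxrank_coker subn_eq0 leqNgt.
  by rewrite (eqP freeA) km.
pose vs' (j : 'I_(1 + k)) :=
  match fintype.split j with inl _ => v | inr j => vs j end.
exists vs'.
have -> : \matrix_j e (vs' j) = col_mx (e v) A :> 'M_(1 + k, m).
  apply/row_matrixP => j; rewrite rowK /vs'.
  case: split_ordP => i ->.
    by rewrite rowKu; apply/rowP => l; rewrite !mxE ord1.
  by rewrite rowKd rowK.
suff H (u : 'rV_(1 + k)) : u *m col_mx (e v) A = 0 -> u = 0.
  by apply: inj_row_free => u; exact: H.
rewrite -[u]hsubmxK mul_row_col => uA.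
have u1 : lsubmx u = 0.
  have : lsubmx u *m (e v *m cokermx A) = 0.
    have := congr1 (mulmx^~ (cokermx A)) uA.
    by rewrite mulmxDl -!mulmxA mulmx_coker mulmx0 addr0 mul0mx.
  rewrite [lsubmx u]mx11_scalar mul_scalar_mx => /eqP.
  by rewrite scaler_eq0 (negPf ev) orbF => /eqP ->; rewrite raddf0.
move: uA; rewrite u1 mul0mx add0r => /eqP.
rewrite mulmx_free_eq0// => /eqP ->.
by rewrite row_mx0.
Qed.

(** A name for the evaluation, to which the structure of ring morphism can be
    attached. *)
Definition eval_at {R : realType} {m} {M : smoothManifold R m} (q : M)
  (f : smoothFun M) : R := f q.

HB.instance Definition _ (R : realType) m (M : smoothManifold R m) (q : M) :=
  GRing.isZmodMorphism.Build (smoothFun M) R (eval_at q) (fun f h => erefl).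
HB.instance Definition _ (R : realType) m (M : smoothManifold R m) (q : M) :=
  GRing.isMonoidMorphism.Build (smoothFun M) R (eval_at q)
    (conj erefl (fun f h => erefl)).

Lemma additive_map0 {V W : zmodType} (f : V -> W) :
  {morph f : x y / x + y} -> f 0 = 0.
Proof.
by move=> /(_ 0 0); rewrite addr0 => /esym/eqP; rewrite -subr_eq0 addrK => /eqP.
Qed.

Section tensoriality.
Context {R : realType} {m : nat} {M : smoothManifold R m}.
Implicit Types (w : vfield M -> smoothFun M) (X Y Z : vfield M) (p q : M).

Definition one_form w := forall f X Y, w (f *: X + Y) = f * w X + w Y.

Lemma one_formD w X Y : one_form w -> w (X + Y) = w X + w Y.
Proof. by move=> lw; rewrite -[X in LHS]scale1r lw mul1r. Qed.

Lemma one_form0 w : one_form w -> w 0 = 0.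
Proof. by move=> lw; apply: additive_map0 => X Y; exact: one_formD. Qed.

Lemma one_formZ w f X : one_form w -> w (f *: X) = f * w X.
Proof. by move=> lw; rewrite -[_ *: _]addr0 lw one_form0// addr0. Qed.

Lemma one_form_sum w (I : Type) (s : seq I) (F : I -> vfield M) : one_form w ->
  w (\sum_(i <- s) F i) = \sum_(i <- s) w (F i).
Proof.
move=> lw; elim/big_rec2: _ => [|i x y _ <-]; first exact: one_form0.
exact: one_formD.
Qed.

(** With [h] a bump function supported where [Z] vanishes, [h *: Z = 0] and so
    [h * w Z = 0], while [h p] is not zero. *)
Lemma one_form_local w Z p : one_form w ->
  (\forall q \near p, forall f, Z f q = 0) -> w Z p = 0.
Proof.
move=> lw Z0; have [h hp h0] := bump_function Z0.
have hZ : h *: Z = 0.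
  apply/vfield_eqP => f; apply/val_inj/funext => q /=.
  have [Zq|/h0 hq] := pselect (forall f, Z f q = 0).
    by change (h q * Z f q = 0); rewrite Zq mulr0.
  by change (h q * Z f q = 0); rewrite hq mul0r.
have : (h * w Z) p = 0 by rewrite -one_formZ// hZ one_form0.
by move=> /eqP; rewrite mulf_eq0 (negPf hp) => /eqP.
Qed.

Lemma vfield_sumE (I : Type) (s : seq I) (F : I -> vfield M) f :
  (\sum_(i <- s) F i) f = \sum_(i <- s) F i f.
Proof. by elim/big_rec2: _ => // i x y _ <-. Qed.

Lemma smoothFun_sumE (I : Type) (s : seq I) (F : I -> smoothFun M) q :
  (\sum_(i <- s) F i) q = \sum_(i <- s) F i q.
Proof. by elim/big_rec2: _ => // i x y _ <-. Qed.

Definition local_frame p (E : 'I_m -> vfield M) : Prop :=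
  \forall q \near p, forall X, exists! c : 'I_m -> R,
    forall f, X f q = \sum_(i < m) c i * E i f q.

(** Choose functions [f_j] whose Jacobian matrix [J] along the frame is
    invertible at [p]. Cramer's rule gives fields [F_k] with
    [F_k f_j = d delta_kj], where [d = det J]. Then
    [Z = d X - sum_k (X f_k) F_k] kills every [f_j], so [Z] vanishes wherever
    [J] is invertible, that is, near [p]. By locality [w Z p = 0], which reads
    [d(p) w(X)(p) = sum_k (X f_k)(p) w(F_k)(p) = 0]. *)
Lemma one_form_pointwise w X p (E : 'I_m -> vfield M) : one_form w ->
  local_frame p E -> (forall f, X f p = 0) -> w X p = 0.
Proof.
move=> lw frE X0.
pose e (f : smoothFun M) := \row_i E i f p.
have [f fJ] : exists f : 'I_m -> smoothFun M, \matrix_j e (f j) \in unitmx.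
  apply: exists_unitmx_rows => c ec.
  have [c' [_ uc']] := nbhs_singleton frE 0.
  have c0 : (fun i => c i ord0) = (fun=> 0).
    rewrite -(uc' (fun i => c i ord0)); last first.
      move=> f; have /matrixP/(_ ord0 ord0) := ec f; rewrite !mxE => ecf.
      change (0 = \sum_i c i ord0 * E i f p); rewrite -[LHS]ecf.
      by apply: eq_bigr => i _; rewrite mxE mulrC.
    apply: uc' => f; rewrite big1// => i _; by rewrite mul0r.
  by apply/matrixP => i j; rewrite ord1 mxE; exact: (congr1 (@^~ i) c0).
pose J : 'M[smoothFun M]_m := \matrix_(j, i) E i (f j).
pose d := \det J.
have dE q : d q = \det (\matrix_(j, i) E i (f j) q).
  rewrite /d -[LHS]/(eval_at q _) -det_map_mx; congr (\det _).
  by apply/matrixP => i j; rewrite !mxE.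
have dp : d p != 0.
  rewrite dE -unitfE -unitmxE.
  suff -> : \matrix_(j, i) E i (f j) p = \matrix_j e (f j) by [].
  by apply/matrixP => i j; rewrite !mxE.
pose F k := \sum_i (\adj J) i k *: E i.
pose Z := d *: X - \sum_k X (f k) *: F k.
have Zf j : Z (f j) = 0.
  change (d * X (f j) - (\sum_k X (f k) *: F k) (f j) = 0).
  rewrite vfield_sumE.
  have Ff k : F k (f j) = d *+ (j == k).
    have := congr1 (fun A : 'M__ => A j k) (mul_mx_adj J).
    rewrite mxE [RHS]mxE => <-.
    by rewrite vfield_sumE; apply: eq_bigr => i _; rewrite [J j i]mxE mulrC.
  rewrite (bigD1 j)//= big1 ?addr0; last first.
    move=> k kj; change (X (f k) * F k (f j) = 0); rewrite Ff eq_sym (negPf kj).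
    by rewrite mulr0n mulr0.
  change (d * X (f j) - X (f j) * F j (f j) = 0).
  by rewrite Ff eqxx mulr1n mulrC subrr.
have wZ : w Z p = 0.
  apply: one_form_local => //.
  have dn : \forall q \near p, d q != 0.
    exact: (cvgr_neq0 _ (@smoothFun_continuous _ _ _ d p) dp).
  near=> q => h.
  have dq : d q != 0 by near: q.
  have [c [cE _]] : exists! c : 'I_m -> R,
      forall f, Z f q = \sum_(i < m) c i * E i f q.
    by move: Z {Zf}; near: q.
  rewrite cE big1// => i _.
  have : (\matrix_(j, i) E i (f j) q) *m (\col_i c i) = 0.
    apply/matrixP => j k; rewrite !mxE.
    transitivity (Z (f j) q); last by rewrite Zf.
    by rewrite cE; apply: eq_bigr => l _; rewrite !mxE mulrC.
  move=> /(congr1 (mulmx (invmx (\matrix_(j, i) E i (f j) q)))).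
  rewrite mulKmx ?mulmx0; last by rewrite unitmxE unitfE -dE.
  by move=> /matrixP/(_ i ord0); rewrite !mxE => ->; rewrite mul0r.
have : d * w X = w Z + \sum_k X (f k) * w (F k).
  have -> : \sum_k X (f k) * w (F k) = w (\sum_k X (f k) *: F k).
    by rewrite one_form_sum//; apply: eq_bigr => k _; rewrite one_formZ.
  by rewrite -one_formD// subrK one_formZ.
move=> /(congr1 (fun h : smoothFun M => h p)).
change (d p * w X p = w Z p + (\sum_k X (f k) * w (F k)) p -> w X p = 0).
rewrite wZ add0r (smoothFun_sumE _ (fun k => X (f k) * w (F k))).
rewrite big1 => [|k _]; last first.
  by change (X (f k) p * w (F k) p = 0); rewrite X0 mul0r.
by move=> /eqP; rewrite mulf_eq0 (negPf dp) => /eqP.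
Unshelve. all: by end_near. Qed.

Lemma one_form_expand (g : metric M) w X p (E : 'I_m -> vfield M) :
  one_form w -> local_orthonormal_frame g p E ->
  w X p = \sum_i g (E i) (E i) p * g X (E i) p * w (E i) p.
Proof.
move=> lw oE.
have frE : local_frame p E by apply: filterS oE => q [].
have [/(_ X)[c [cE _]] En Eo] := nbhs_singleton oE.
pose K i := c i *: (1 : smoothFun M).
have expand v : one_form v -> v X p = \sum_i c i * v (E i) p.
  move=> lv.
  have XE f : (X - \sum_i K i *: E i) f p = 0.
    change (X f p - (\sum_i K i *: E i) f p = 0); rewrite cE.
    rewrite vfield_sumE smoothFun_sumE; apply/eqP; rewrite subr_eq0; apply/eqP.
    apply: eq_bigr => i _; change (c i * E i f p = c i * 1 * E i f p).
    by rewrite mulr1.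
  have := one_form_pointwise lv frE XE.
  have -> : v X = v (X - \sum_i K i *: E i) + v (\sum_i K i *: E i).
    by rewrite -one_formD// subrK.
  move=> vE; change (v (X - \sum_i K i *: E i) p + v (\sum_i K i *: E i) p =
    \sum_i c i * v (E i) p).
  rewrite vE add0r one_form_sum// smoothFun_sumE; apply: eq_bigr => i _.
  rewrite one_formZ//; change (c i * 1 * v (E i) p = c i * v (E i) p).
  by rewrite mulr1.
rewrite (expand w)//; apply: eq_bigr => i _.
rewrite (expand (fun X => g X (E i))); last first.
  by move=> f Y Z; exact: metric_linearl.
rewrite (bigD1 i)//= big1 => [|j ji]; last by rewrite Eo ?mulr0.
by case: (En i) => ->; ring.
Qed.

End tensoriality.

(** * Curvature of a Levi-Civita connection *)

(** Proves an equation as a linear combination [c = d] of known ones, the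
    remaining goal being a ring identity. *)
Lemma eq_by_sub {V : zmodType} (a b c d : V) : c = d -> a - b = c - d -> a = b.
Proof. by move=> -> /eqP; rewrite subrr subr_eq0 => /eqP. Qed.

Lemma smoothFun_double_inj {R : realType} {m} {M : smoothManifold R m}
  (a b : smoothFun M) : a + a = b + b -> a = b.
Proof.
move=> ab; apply/val_inj/funext => p.
have : a p + a p = b p + b p by exact: (congr1 (fun f : smoothFun M => f p) ab).
by move=> abp; change (a p = b p); lra.
Qed.

Section metric_theory.
Context {R : realType} {m : nat} {M : smoothManifold R m}.
Implicit Types (f h : smoothFun M) (X Y Z V W : vfield M).

Lemma vfieldDE X Y f : (X + Y) f = X f + Y f. Proof. by []. Qed.
Lemma vfieldNE X f : (- X) f = - X f. Proof. by []. Qed.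
Lemma vfieldZE f X h : (f *: X) h = f * X h. Proof. by []. Qed.
Lemma lieE X Y f : lie X Y f = X (Y f) - Y (X f). Proof. by []. Qed.

Lemma vfieldD X f h : X (f + h) = X f + X h.
Proof. by have [lX _] := vfieldP X; rewrite -[f in LHS]scale1r lX scale1r. Qed.

Lemma vfieldM X f h : X (f * h) = X f * h + f * X h.
Proof. by have [_ ->] := vfieldP X. Qed.

Lemma vfield0 X : X 0 = 0.
Proof. exact: (additive_map0 (vfieldD X)). Qed.

Lemma vfieldN X f : X (- f) = - X f.
Proof. by apply/eqP; rewrite -addr_eq0 -vfieldD addNr vfield0. Qed.

Lemma lieZl f X Y : lie (f *: X) Y = f *: lie X Y - Y f *: X.
Proof.
apply/vfield_eqP => u.
rewrite !(vfieldDE, vfieldNE, vfieldZE, lieE) vfieldM; ring.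
Qed.

Lemma lieC X Y : lie X Y = - lie Y X.
Proof. by apply/vfield_eqP => u; rewrite !(vfieldNE, lieE) opprB. Qed.

Lemma jacobi X Y Z : lie X (lie Y Z) = - lie Y (lie Z X) - lie Z (lie X Y).
Proof.
apply/vfield_eqP => u.
rewrite !(vfieldDE, vfieldNE, lieE, vfieldD, vfieldN); ring.
Qed.

Lemma lieDl X Y Z : lie (X + Y) Z = lie X Z + lie Y Z.
Proof. apply/vfield_eqP => u; rewrite !(vfieldDE, lieE, vfieldD); ring. Qed.

Context (g : metric M).

Lemma metricC X Y : g X Y = g Y X. Proof. exact: Defs.metric_sym. Qed.
Lemma metricDl X Y Z : g (X + Y) Z = g X Z + g Y Z.
Proof. by rewrite -[X in LHS]scale1r metric_linearl mul1r. Qed.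
Lemma metric0l Z : g 0 Z = 0.
Proof. by apply: (additive_map0 (f := g^~ Z)) => X Y; exact: metricDl. Qed.
Lemma metricZl f X Z : g (f *: X) Z = f * g X Z.
Proof. by rewrite -[_ *: _]addr0 metric_linearl metric0l addr0. Qed.
Lemma metricNl X Z : g (- X) Z = - g X Z.
Proof. by rewrite -scaleN1r metricZl mulN1r. Qed.
Lemma metricDr X Y Z : g Z (X + Y) = g Z X + g Z Y.
Proof. by rewrite !(metricC Z) metricDl. Qed.
Lemma metricZr f X Z : g Z (f *: X) = f * g Z X.
Proof. by rewrite !(metricC Z) metricZl. Qed.
Lemma metricNr X Z : g Z (- X) = - g Z X.
Proof. by rewrite !(metricC Z) metricNl. Qed.
Lemma metric0r Z : g Z 0 = 0.
Proof. by rewrite metricC metric0l. Qed.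

Definition metricE := (metricDl, metricDr, metricZl, metricZr, metricNl,
  metricNr, metric0l, metric0r).

Lemma metric_inj X Y : (forall V, g X V = g Y V) -> X = Y.
Proof.
move=> XY; apply/eqP; rewrite -subr_eq0; apply/eqP/vfield_eqP => f.
apply/val_inj/funext => p.
change ((X - Y) f p = 0).
suff H V : g (X - Y) V p = 0 by exact: Defs.metric_nondegenerate H f.
by rewrite metricDl metricNl XY subrr.
Qed.

Context (nabla : vfield M -> vfield M -> vfield M) (lc : levi_civita g nabla).

Lemma nablaDl X Y Z : nabla (X + Y) Z = nabla X Z + nabla Y Z.
Proof. by rewrite -[X in LHS]scale1r (connection_linearl lc) scale1r. Qed.
Lemma nabla0l Z : nabla 0 Z = 0.
Proof. by apply: (additive_map0 (f := nabla^~ Z)) => X Y; exact: nablaDl. Qed.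
Lemma nablaZl f X Z : nabla (f *: X) Z = f *: nabla X Z.
Proof. by rewrite -[_ *: _]addr0 (connection_linearl lc) nabla0l addr0. Qed.
Lemma nablaNl X Z : nabla (- X) Z = - nabla X Z.
Proof. by rewrite -scaleN1r nablaZl scaleN1r. Qed.
Lemma nablaDr X Y Z : nabla X (Y + Z) = nabla X Y + nabla X Z.
Proof. exact: connection_additive lc X Y Z. Qed.
Lemma nabla0r Z : nabla Z 0 = 0.
Proof. exact: (additive_map0 (nablaDr Z)). Qed.
Lemma nablaNr X Y : nabla X (- Y) = - nabla X Y.
Proof. by apply/eqP; rewrite -addr_eq0 -nablaDr addNr nabla0r. Qed.
Lemma nablaZr f X Y : nabla X (f *: Y) = X f *: Y + f *: nabla X Y.
Proof. exact: connection_leibniz lc f X Y. Qed.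
Definition nablaE := (nablaDl, nablaNl, nablaZl, nablaDr, nablaNr, nablaZr).

Lemma lie_nabla X Y : lie X Y = nabla X Y - nabla Y X.
Proof. by rewrite (connection_torsion_free lc). Qed.

Definition curv X Y Z V := g (riemann nabla X Y Z) V.

Lemma curvE X Y Z V : curv X Y Z V =
  g (nabla X (nabla Y Z)) V - g (nabla Y (nabla X Z)) V
  - g (nabla (lie X Y) Z) V.
Proof. by rewrite /curv /riemann !metricE. Qed.

Lemma curv_antisym X Y Z V : curv X Y Z V = - curv Y X Z V.
Proof. rewrite !curvE (lieC X Y) !(nablaE, metricE); ring. Qed.

Lemma curv_linear1 Y Z V : one_form (fun X => curv X Y Z V).
Proof.
move=> f X X'.
rewrite !curvE lieDl lieZl !(nablaE, metricE); ring.
Qed.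

Lemma curv_linear3 X Y V : one_form (fun Z => curv X Y Z V).
Proof.
move=> f Z Z'.
rewrite !curvE !(nablaE, metricE) !(lieE); ring.
Qed.

Lemma metric_nabla X Y Z : X (g Y Z) = g (nabla X Y) Z + g Y (nabla X Z).
Proof. exact: connection_metric lc X Y Z. Qed.

Lemma curv_skew X Y Z V : curv X Y Z V = - curv X Y V Z.
Proof.
have := lieE X Y (g Z V).
rewrite !metric_nabla !(vfieldD, metric_nabla) !curvE !(metricC _ Z) => E.
apply: (eq_by_sub (esym E)); ring.
Qed.

Lemma curv_bianchi X Y Z V : curv X Y Z V = - curv Y Z X V - curv Z X Y V.
Proof.
have L A B C : nabla (lie A B) C =
    nabla C (nabla A B) - nabla C (nabla B A) - lie C (lie A B).
  by rewrite -nablaNr -nablaDr -lie_nabla (lie_nabla C) opprB addrC subrK.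
rewrite !curvE !L (jacobi X Y Z) !metricE; ring.
Qed.

(** The usual octahedron: in the sum of the four first Bianchi identities of
    the cyclic shifts of [(X, Y, Z, V)], with signs [+ + - -], everything
    cancels except twice the two members. *)
Lemma curv_pair X Y Z V : curv X Y Z V = curv Z V X Y.
Proof.
apply: smoothFun_double_inj.
have := curv_bianchi X Y Z V; have := curv_bianchi Y Z V X.
have := curv_bianchi Z V X Y; have := curv_bianchi V X Y Z.
rewrite (curv_skew Y Z V X) (curv_skew Z V Y X) (curv_antisym V Y Z X).
rewrite (curv_antisym V X Z Y) (curv_skew X V Z Y).
rewrite (curv_antisym X Z V Y) (curv_skew Z X V Y).
rewrite (curv_antisym V X Y Z) (curv_skew X Y V Z) (curv_skew Y V X Z).
move=> b4 b3 b2 b1.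
apply: (eq_by_sub (congr2 +%R (congr2 +%R b1 b2)
  (congr2 +%R (esym b3) (esym b4)))).
ring.
Qed.

Context (e : smoothFun M).

(** The deviation of the curvature from that of a space of constant sectional
    curvature [- e]. *)
Definition curv_dev X Y Z V :=
  curv X Y Z V + e * (g Y Z * g X V - g X Z * g Y V).

Lemma curv_dev_antisym X Y Z V : curv_dev X Y Z V = - curv_dev Y X Z V.
Proof. rewrite /curv_dev (curv_antisym X); ring. Qed.

Lemma curv_dev_skew X Y Z V : curv_dev X Y Z V = - curv_dev X Y V Z.
Proof. rewrite /curv_dev (curv_skew X); ring. Qed.

Lemma curv_dev_bianchi X Y Z V :
  curv_dev X Y Z V = - curv_dev Y Z X V - curv_dev Z X Y V.
Proof.
rewrite /curv_dev (curv_bianchi X) (metricC Z X) (metricC Z Y).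
rewrite (metricC Y X); ring.
Qed.

Lemma curv_dev_pair X Y Z V : curv_dev X Y Z V = curv_dev Z V X Y.
Proof.
rewrite /curv_dev (curv_pair X) (metricC Z X) (metricC Z Y) (metricC V X).
rewrite (metricC V Y); ring.
Qed.

Lemma curv_dev_linear1 Y Z V : one_form (fun X => curv_dev X Y Z V).
Proof. move=> f X X'; rewrite /curv_dev curv_linear1 !metricE; ring. Qed.

Lemma curv_dev_linear2 X Z V : one_form (fun Y => curv_dev X Y Z V).
Proof. move=> f Y Y'; rewrite !(curv_dev_antisym X) curv_dev_linear1; ring. Qed.

Lemma curv_dev_linear3 X Y V : one_form (fun Z => curv_dev X Y Z V).
Proof. move=> f Z Z'; rewrite /curv_dev curv_linear3 !metricE; ring. Qed.

Lemma curv_dev_linear4 X Y Z : one_form (curv_dev X Y Z).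
Proof. by move=> f V V'; rewrite /curv_dev /curv !metricE; ring. Qed.

End metric_theory.

(** * Traces in an orthonormal frame *)

Section trace.
Context {R : realType} {m : nat} {M : smoothManifold R m} (g : metric M).
Context (q : M) (E : 'I_m -> vfield M) (oE : local_orthonormal_frame g q E).

Definition trace_at (B : vfield M -> vfield M -> smoothFun M) : R :=
  \sum_i g (E i) (E i) q * B (E i) (E i) q.

Lemma eq_trace_at B C : (forall X, B X X = C X X) -> trace_at B = trace_at C.
Proof. by move=> BC; apply: eq_bigr => i _; rewrite BC. Qed.

Lemma trace_atN B : trace_at (fun X Y => - B X Y) = - trace_at B.
Proof. by rewrite /trace_at -sumrN; apply: eq_bigr => i _; rewrite -mulrN. Qed.

Lemma trace_atD B C :
  trace_at (fun X Y => B X Y + C X Y) = trace_at B + trace_at C.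
Proof.
by rewrite /trace_at -big_split; apply: eq_bigr => i _; exact: mulrDr.
Qed.

(** A skew-adjoint endomorphism moves across a trace at the price of a sign,
    as seen by expanding [f (E i)] in the frame on both sides. *)
Lemma trace_at_skew B f :
  (forall Y, one_form (B^~ Y)) -> (forall X, one_form (B X)) ->
  (forall X Y, g (f X) Y = - g X (f Y)) ->
  trace_at (fun X Y => B (f X) Y) = - trace_at (fun X Y => B X (f Y)).
Proof.
move=> B1 B2 fs.
have L i : B (f (E i)) (E i) q =
    \sum_j g (E j) (E j) q * g (f (E i)) (E j) q * B (E j) (E i) q.
  by rewrite -(one_form_expand (f (E i)) (B1 (E i)) oE).
have Rr i : B (E i) (f (E i)) q =
    \sum_j g (E j) (E j) q * g (f (E i)) (E j) q * B (E i) (E j) q.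
  by rewrite -(one_form_expand (f (E i)) (B2 (E i)) oE).
rewrite /trace_at; under eq_bigr do rewrite L mulr_sumr.
under [in RHS]eq_bigr do rewrite Rr mulr_sumr.
rewrite exchange_big -sumrN; apply: eq_bigr => i _; rewrite -sumrN.
apply: eq_bigr => j _; rewrite fs (metricC g (E j)).
change (g (E j) (E j) q *
  (g (E i) (E i) q * - g (f (E i)) (E j) q * B (E i) (E j) q) =
  - (g (E i) (E i) q *
     (g (E j) (E j) q * g (f (E i)) (E j) q * B (E i) (E j) q))).
ring.
Qed.

Lemma trace_at_metric X Y :
  trace_at (fun U V => g X U * g V Y) = g X Y q.
Proof.
rewrite (one_form_expand X _ oE (w := fun X => g X Y)); last first.
  by move=> *; exact: metric_linearl.
by apply: eq_bigr => i _; rewrite mulrA.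
Qed.

Lemma trace_at_dim : trace_at g = m%:R.
Proof.
rewrite /trace_at (eq_bigr (fun=> 1)) => [|i _].
  by rewrite sumr_const card_ord.
have [_ Ei _] := nbhs_singleton oE.
by case: (Ei i) => ->; rewrite ?mulr1// mulrNN mulr1.
Qed.

End trace.

(** * The covariant derivative of a paraSasakian structure *)

Section para_sasakian.
Context {R : realType} {m : nat} {M : smoothManifold R m}.
Implicit Types (f h : smoothFun M) (X Y Z V W : vfield M).
Context (g : metric M) (nabla : vfield M -> vfield M -> vfield M).
Context (lc : levi_civita g nabla) (eps : int) (s : structure M).
Context (sas : paraSasakian g eps s).

Let p : vfield M -> vfield M := phi s.
Let x := xi s.
Let n : vfield M -> smoothFun M := eta s.
Let e : smoothFun M := eps%:~R.

Lemma phiD X Y : p (X + Y) = p X + p Y. Proof. exact: linearD. Qed.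
Lemma phiN X : p (- X) = - p X. Proof. exact: linearN. Qed.
Lemma phiZ f X : p (f *: X) = f *: p X. Proof. exact: linearZ. Qed.
Lemma etaD X Y : n (X + Y) = n X + n Y. Proof. exact: linearD. Qed.
Lemma etaN X : n (- X) = - n X. Proof. exact: linearN. Qed.
Lemma etaZ f X : n (f *: X) = f * n X. Proof. exact: linearZ. Qed.
Definition phi_etaE := (phiD, phiN, phiZ, etaD, etaN, etaZ).

Lemma phi_sqr X : p (p X) = X - n X *: x.
Proof. by case: sas => -[H _] _ _ _; exact: H. Qed.
Lemma eta_xi : n x = 1.
Proof. by case: sas => -[]. Qed.
Lemma eps_sqr : e * e = 1.
Proof.
by case: sas => _ [[] E _ _] _ _; rewrite /e E ?mulr1// mulrNN mulr1.
Qed.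
Lemma vfield_eps X f : X (e * f) = e * X f.
Proof.
case: sas => _ [[] E _ _] _ _; rewrite /e E; first by rewrite !mul1r.
by rewrite !mulN1r vfieldN.
Qed.
Lemma metric_xi_xi : g x x = e.
Proof. by case: sas => _ [_ H _] _ _; exact: H. Qed.
Lemma metric_phi_phi X Y : g (p X) (p Y) = e * (n X * n Y) - g X Y.
Proof. by case: sas => _ [_ _ H] _ _; rewrite H mulrN1z opprB. Qed.
Lemma dEta X Y : X (n Y) - Y (n X) - n (lie X Y) = g X (p Y) + g X (p Y).
Proof.
case: sas => _ _ _ /(_ X Y); rewrite /fundamental_form => <-.
have h1 : 2^-1 + 2^-1 = 1 :> R by field.
by rewrite /ext_deriv -scalerDl h1 scale1r.
Qed.
Lemma normality X Y : nijenhuis (phi s) X Y = (g X (p Y) + g X (p Y)) *: x.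
Proof.
case: sas => _ _ /(_ X Y) -> D; congr (_ *: _).
by rewrite D /fundamental_form scaler_nat mulr2n.
Qed.

(** From [phi (phi xi) = 0], [phi^2] at [phi xi] gives [phi xi = c xi] with
    [c = eta (phi xi)]; then [0 = phi (phi xi) = c^2 xi], so [c^2 = 0], and
    the ring of smooth functions is reduced. *)
Lemma phi_xi : p x = 0.
Proof.
have p2x : p (p x) = 0 by rewrite phi_sqr eta_xi scale1r subrr.
have pxE : p x = n (p x) *: x.
  have := phi_sqr (p x); rewrite p2x /p linear0 => /esym/eqP.
  by rewrite subr_eq0 => /eqP.
suff n0 : n (p x) = 0 by rewrite pxE n0 scale0r.
have nn : n (p x) * n (p x) = 0.
  have := congr1 n p2x; rewrite pxE phiZ {2}pxE !etaZ eta_xi !mulr1 => ->.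
  exact: linear0.
apply/val_inj/funext => q; change (n (p x) q = 0).
have := congr1 (fun f : smoothFun M => f q) nn.
change (n (p x) q * n (p x) q = 0 -> n (p x) q = 0) => /eqP.
by rewrite mulf_eq0 orbb => /eqP.
Qed.

Lemma metric_xi X : g X x = e * n X.
Proof.
have := metric_phi_phi X x; rewrite phi_xi metric0r eta_xi mulr1 => /esym/eqP.
by rewrite subr_eq0 => /eqP.
Qed.

Lemma eta_phi X : n (p X) = 0.
Proof.
have := congr1 p (phi_sqr X); rewrite phi_sqr !phi_etaE phi_xi scaler0 subr0.
move=> /(congr1 n); rewrite !phi_etaE eta_xi mulr1 subrr => <- //.
Qed.

Lemma phi_skew X Y : g (p X) Y = - g X (p Y).
Proof.
have := metric_phi_phi X (p Y).
by rewrite phi_sqr eta_phi !metricE metric_xi eta_phi !mulr0 !subr0 sub0r.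
Qed.

(** The covariant derivative of [phi], [g ((nabla_X phi) Y, Z)]. *)
Let F X Y Z := g (nabla X (p Y) - p (nabla X Y)) Z.
Let a X Y := g (nabla X x) Y.

Lemma nabla_phi_skew X Y Z : F X Y Z = - F X Z Y.
Proof.
have := congr1 X (phi_skew Y Z).
rewrite vfieldN !(metric_nabla lc) /F !metricE !phi_skew => E.
rewrite (metricC g (nabla X Z)) phi_skew (metricC g _ Y).
apply: (eq_by_sub E); ring.
Qed.

Lemma nabla_eta X Y : X (n Y) = n (nabla X Y) + e * a X Y.
Proof.
have := metric_nabla lc X Y x; rewrite !metric_xi vfield_eps => E.
have := congr1 ( *%R e) E; rewrite mulrDr !mulrA eps_sqr !mul1r => ->.
by rewrite (metricC g Y).
Qed.

Lemma nabla_xi_antisym X Y : a X Y - a Y X = e * (g X (p Y) + g X (p Y)).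
Proof.
rewrite -dEta !nabla_eta (lie_nabla lc) !phi_etaE.
transitivity (e * e * (a X Y - a Y X)); first by rewrite eps_sqr mul1r.
ring.
Qed.

(** The fundamental form is closed, being [d eta]: with [d eta] written out,
    this is the Jacobi identity. *)
Lemma dPhi X Y Z :
  (X (g Y (p Z)) - g (lie X Y) (p Z)) + (Y (g Z (p X)) - g (lie Y Z) (p X))
  + (Z (g X (p Y)) - g (lie Z X) (p Y)) = 0.
Proof.
apply: smoothFun_double_inj; rewrite addr0.
have D (A B C : vfield M) : A (g B (p C)) + A (g B (p C)) =
    A (B (n C)) - A (C (n B)) - A (n (lie B C)).
  by rewrite -vfieldD -dEta !(vfieldD, vfieldN).
transitivity (
  ((X (g Y (p Z)) + X (g Y (p Z))) - (g (lie X Y) (p Z) + g (lie X Y) (p Z)))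
 + ((Y (g Z (p X)) + Y (g Z (p X))) - (g (lie Y Z) (p X) + g (lie Y Z) (p X)))
 + ((Z (g X (p Y)) + Z (g X (p Y))) - (g (lie Z X) (p Y) + g (lie Z X) (p Y)))).
  ring.
rewrite !D -!dEta !lieE (lieC (lie X Y)) (lieC (lie Y Z)) (lieC (lie Z X)).
rewrite (jacobi X) !phi_etaE; ring.
Qed.

Lemma nabla_phi_cyclic X Y Z : F X Y Z + F Y Z X + F Z X Y = 0.
Proof.
have := dPhi X Y Z; rewrite !(metric_nabla lc) !(lie_nabla lc) => E.
have FE A B C : g C (nabla A (p B)) = F A B C - g (nabla A B) (p C).
  by rewrite /F !metricE phi_skew opprK addrK metricC.
rewrite !FE !metricE in E.
rewrite (nabla_phi_skew X Y) (nabla_phi_skew Y Z) (nabla_phi_skew Z X).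
apply: (eq_by_sub (esym E)); ring.
Qed.

(** Normality, with the brackets of the Nijenhuis tensor replaced by covariant
    derivatives. *)
Lemma nabla_phi_normal X Y V :
  F (p X) Y V - F (p Y) X V + F X Y (p V) - F Y X (p V) =
  e * n V * (g X (p Y) + g X (p Y)).
Proof.
have := congr1 (g^~ V) (normality X Y); rewrite /nijenhuis.
rewrite -!/(p _) !(lie_nabla lc) !phi_etaE !metricE !phi_skew.
rewrite (metricC g x) metric_xi => E.
rewrite /F !metricE !phi_skew; apply: (eq_by_sub E); ring.
Qed.

(** The covariant derivative of [phi^2 = I - eta (x) xi]. *)
Lemma nabla_phi_phi X Y Z :
  F X (p Y) Z - F X Y (p Z) = - (n Z * a X Y) - n Y * a X Z.
Proof.
rewrite /F !phi_sqr !(nablaE lc) !metricE (metricC g x) !metric_xi.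
rewrite nabla_eta !phi_skew -/(a X Z) phi_sqr !metricE metric_xi.
transitivity (- (e * e * (n Z * a X Y)) - n Y * a X Z); first by ring.
by rewrite eps_sqr mul1r.
Qed.

(** Normality expresses [F (phi Y) Z V + F Y (phi Z) V - (Y <-> Z)] by [a],
    once [phi] is moved from the last to the middle slot by [nabla_phi_phi];
    the cyclic identity turns this into [- F V (phi Y) Z - F V Y (phi Z)], and
    [nabla_phi_phi] gives the difference of these two terms. *)
Lemma nabla_phi_image V Y Z :
  F V Y (p Z) + F V Y (p Z) =
  e * n Y * (g V (p Z) + g V (p Z)) + n Z * (a Y V + a V Y).
Proof.
have N := nabla_phi_normal Y Z V.
have d1 := nabla_phi_phi Y Z V.
have d2 := nabla_phi_phi Z Y V.
have d3 := nabla_phi_phi V Y Z.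
have c1 := nabla_phi_cyclic Y (p Z) V.
have c2 := nabla_phi_cyclic (p Y) Z V.
have s1 := congr1 ( *%R (n V)) (nabla_xi_antisym Y Z).
have s2 := congr1 ( *%R (n Y)) (nabla_xi_antisym V Z).
rewrite (nabla_phi_skew _ V Y) in c1; rewrite (nabla_phi_skew _ V (p Y)) in c2.
pose add := congr2 (@GRing.add (smoothFun M)).
have sum := add _ _ _ _ (add _ _ _ _ (esym N) (esym d1))
  (add _ _ _ _ (esym d3) d2).
apply: (eq_by_sub (add _ _ _ _ sum
  (add _ _ _ _ (add _ _ _ _ c1 c2) (add _ _ _ _ s1 s2)))).
ring.
Qed.

(** At [Z = xi] the left side of [nabla_phi_image] is zero, so the symmetric
    part of [nabla xi] vanishes: [xi] is a Killing field. The antisymmetric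
    part is given by [d eta]. *)
Lemma nabla_xiE X Y : a X Y = e * g X (p Y).
Proof.
have := nabla_phi_image X Y x.
rewrite phi_xi !metric0r eta_xi !addr0 mulr0 add0r mul1r => K.
have S := nabla_xi_antisym X Y; apply: smoothFun_double_inj.
apply: (eq_by_sub (congr2 +%R (esym K) S)); rewrite /F metric0r; ring.
Qed.

Lemma nabla_xi X : nabla X x = - (e *: p X).
Proof.
apply: (metric_inj (g := g)) => V.
by rewrite !metricE phi_skew mulrN opprK -nabla_xiE.
Qed.

(** [nabla_phi_image], now free of the symmetric part of [nabla xi], gives
    [g ((nabla_X phi) Y, Z)] for [Z] in the image of [phi], and the component
    along [xi] follows from [nabla_xi]; every [Z] is the sum of [phi (phi Z)]
    and a multiple of [xi]. *)
Lemma nabla_phi X Y :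
  nabla X (p Y) = p (nabla X Y) + (e * n Y) *: X - g X Y *: x.
Proof.
have image Z : F X Y (p Z) = e * n Y * g X (p Z).
  apply: smoothFun_double_inj; rewrite nabla_phi_image !nabla_xiE.
  rewrite (metricC g Y) phi_skew; ring.
have Fx : F X Y x = - (e * g X (p (p Y))).
  rewrite nabla_phi_skew /F phi_xi (nabla0r lc) !metricE phi_skew.
  by rewrite opprK add0r -nabla_xiE.
apply: (metric_inj (g := g)) => Z.
have FE : F X Y (p (p Z)) = F X Y Z - n Z * F X Y x.
  by rewrite phi_sqr /F !metricE; ring.
have := image (p Z); rewrite FE Fx !phi_sqr !metricE !metric_xi /F !metricE.
rewrite (metricC g x) metric_xi => E; apply: (eq_by_sub E); ring.
Qed.

(** Taking the covariant derivative of [nabla_phi] and using [nabla_xi] gives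
    the commutator of [R(X, Y)] with [phi] as an explicit expression in [g]
    and [phi], and the constant curvature term in [curv_dev] has the opposite
    commutator. As [phi] is skew-adjoint, the statement says that [curv_dev]
    commutes with it. *)
Lemma curv_dev_phi X Y Z V :
  curv_dev g nabla e X Y (p Z) V = - curv_dev g nabla e X Y Z (p V).
Proof.
rewrite /curv_dev !curvE !(lie_nabla lc) !(nabla_phi, nabla_xi, nablaE lc).
rewrite !(vfieldD, vfieldN, vfield_eps, nabla_eta, metric_nabla lc, nabla_xiE).
rewrite !phi_etaE !metricE !phi_skew !(metricC g x) !metric_xi.
have epsK z : e * (e * z) = z by rewrite mulrA eps_sqr mul1r.
rewrite !epsK; ring.
Qed.

Lemma curv_dev_xi X Y Z : curv_dev g nabla e X Y Z x = 0.
Proof.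
have xx : curv_dev g nabla e X Y x x = 0.
  apply: smoothFun_double_inj; rewrite addr0 {1}(curv_dev_skew lc) addNr //.
have xphi V : curv_dev g nabla e X Y x (p V) = 0.
  apply/eqP; rewrite -oppr_eq0 -curv_dev_phi phi_xi.
  by rewrite (one_form0 (curv_dev_linear3 lc e X Y V)).
have := xphi (p Z); rewrite phi_sqr -scaleNr addrC curv_dev_linear4.
rewrite xx mulr0 add0r.
by rewrite [in X in _ -> X](curv_dev_skew lc) => ->; rewrite oppr0.
Qed.
End para_sasakian.

(** * Ricci tensor of two anticommuting paraSasakian structures *)

Section ricci.
Context {R : realType} {m : nat} {M : smoothManifold R m}.
Implicit Types (X Y Z V : vfield M).
Context (g : metric M) (nabla : vfield M -> vfield M -> vfield M).
Context (lc : levi_civita g nabla) (eps0 eps1 : int) (s0 s1 : structure M).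
Context (sas0 : paraSasakian g eps0 s0) (sas1 : paraSasakian g eps1 s1).
Context (eps01 : eps0%:~R = eps1%:~R :> smoothFun M).
Context (anticomm : forall X, phi s1 (phi s0 X) =
  - phi s0 (phi s1 X) - eta s1 X *: xi s0 - eta s0 X *: xi s1).

Let e : smoothFun M := eps0%:~R.
Let W := curv_dev g nabla e.
Local Notation p0 := (phi s0).
Local Notation p1 := (phi s1).

Lemma curv_dev_phi0 X Y Z V : W X Y (p0 Z) V = - W X Y Z (p0 V).
Proof. exact: (curv_dev_phi lc sas0). Qed.

Lemma curv_dev_phi1 X Y Z V : W X Y (p1 Z) V = - W X Y Z (p1 V).
Proof. rewrite /W /e eps01; exact: (curv_dev_phi lc sas1). Qed.

Lemma curv_dev_xi0 X Y Z : W X Y Z (xi s0) = 0.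
Proof. exact: (curv_dev_xi lc sas0). Qed.

Lemma curv_dev_xi1 X Y Z : W X Y Z (xi s1) = 0.
Proof. rewrite /W /e eps01; exact: (curv_dev_xi lc sas1). Qed.

Let dev4D X Y Z V V' : W X Y Z (V + V') = W X Y Z V + W X Y Z V'.
Proof. by apply: one_formD; exact: curv_dev_linear4. Qed.
Let dev4Z X Y Z f V : W X Y Z (f *: V) = f * W X Y Z V.
Proof. by apply: one_formZ; exact: curv_dev_linear4. Qed.
Let dev4N X Y Z V : W X Y Z (- V) = - W X Y Z V.
Proof. by rewrite -scaleN1r dev4Z mulN1r. Qed.

Lemma curv_dev_phi101 X Y Z V : W X Y Z (p1 (p0 (p1 V))) = - W X Y Z (p0 V).
Proof.
rewrite anticomm !(dev4D, dev4N, dev4Z) curv_dev_xi0 curv_dev_xi1.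
rewrite !mulr0 !subr0; congr (- _).
apply/oppr_inj; rewrite -!curv_dev_phi0 (phi_sqr sas1) -scaleNr addrC.
rewrite !(dev4D, dev4Z).
by rewrite curv_dev_xi1 mulr0 add0r.
Qed.

Context (q : M) (E : 'I_m -> vfield M) (oE : local_orthonormal_frame g q E).
Let tr := trace_at g q E.

(** Up to sign this is the trace of [phi_0 o W(X, Y)]. Insert [phi_1 o phi_1],
    which is the identity on the image of [W(X, Y)], move one factor around
    the trace through [W(X, Y)], and anticommute it past [phi_0]: the trace
    equals its opposite. *)
Lemma trace_phi_curv_dev X Y : tr (fun Z V => W X Y Z (p0 V)) = 0.
Proof.
suff: tr (fun Z V => W X Y Z (p0 V)) = - tr (fun Z V => W X Y Z (p0 V)) by lra.
transitivity (- tr (fun Z V => W X Y (p1 Z) (p1 (p0 V)))).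
  rewrite -trace_atN; apply: eq_trace_at => Z.
  rewrite curv_dev_phi1 opprK.
  rewrite (phi_sqr sas1) -scaleNr addrC dev4D dev4Z curv_dev_xi1 mulr0 add0r //.
have -> : tr (fun Z V => W X Y (p1 Z) (p1 (p0 V))) =
    - tr (fun Z V => W X Y Z (p1 (p0 (p1 V)))).
  apply: (trace_at_skew oE (B := fun Z V => W X Y Z (p1 (p0 V))) (f := p1)).
  - by move=> V; exact: (curv_dev_linear3 lc).
  - by move=> Z f V V'; rewrite !linearP dev4D dev4Z.
  - exact: (phi_skew sas1).
by rewrite opprK -trace_atN; apply: eq_trace_at => Z; exact: curv_dev_phi101.
Qed.

Let ric X Y := tr (fun U V => W U X Y V).

Lemma ricci_phi X Y : ric X (p0 Y) = - tr (fun U V => W U X Y (p0 V)).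
Proof.
by rewrite -trace_atN; apply: eq_trace_at => U; exact: curv_dev_phi0.
Qed.

(** The antisymmetric part of [ric X (phi_0 Y)] is, by the first Bianchi
    identity, the trace of [phi_0 o W(X, Y)]. *)
Lemma ricci_phi_sym X Y : ric X (p0 Y) = ric Y (p0 X).
Proof.
have t0 := trace_phi_curv_dev X Y.
suff : tr (fun U V => W U X Y (p0 V)) =
    - tr (fun U V => W X Y U (p0 V)) + tr (fun U V => W U Y X (p0 V)).
  by rewrite !ricci_phi t0 => ->; rewrite oppr0 add0r.
rewrite -trace_atN -trace_atD; apply: eq_trace_at => U.
by rewrite /W (curv_dev_bianchi lc) (curv_dev_antisym lc e Y U) opprK.
Qed.

(** By pair symmetry [phi_0] acts on the first pair of arguments of [W] too;
    it is moved from [Y] to the summation index, across the trace, and then to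
    [X]. *)
Lemma ricci_phi_antisym X Y : ric X (p0 Y) = - ric Y (p0 X).
Proof.
have -> : ric X (p0 Y) = - tr (fun U V => W Y (p0 U) V X).
  rewrite -trace_atN; apply: eq_trace_at => U.
  rewrite {1}/W (curv_dev_pair lc) -/W {1}/W (curv_dev_antisym lc) -/W.
  rewrite {1}/W (curv_dev_antisym lc) -/W opprK.
  rewrite {1}/W (curv_dev_pair lc) -/W curv_dev_phi0.
  by rewrite {1}/W (curv_dev_pair lc).
have -> : tr (fun U V => W Y (p0 U) V X) = - tr (fun U V => W Y U (p0 V) X).
  apply: (trace_at_skew oE (B := fun U V => W Y U V X) (f := p0)).
  - by move=> V; exact: (curv_dev_linear2 lc).
  - by move=> U; exact: (curv_dev_linear3 lc).
  - exact: (phi_skew sas0).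
rewrite opprK -trace_atN; apply: eq_trace_at => U.
rewrite curv_dev_phi0; congr (- _).
by rewrite {1}/W (curv_dev_antisym lc) (curv_dev_skew lc) opprK.
Qed.

Lemma ricci_curv_dev0 X Y : ric X Y = 0.
Proof.
have ricphi V : ric X (p0 V) = 0.
  have := ricci_phi_sym X V; have := ricci_phi_antisym X V; lra.
have := ricphi (p0 Y); rewrite (phi_sqr sas0) => <-.
apply: eq_trace_at => U.
rewrite /W !(curv_dev_skew lc e U X _ U) -/W -scaleNr addrC dev4D dev4Z.
by rewrite curv_dev_xi0 mulr0 add0r.
Qed.

(** The constant curvature term contributes [g(X, Y)] times the dimension,
    minus [g(X, Y)]. *)
Lemma trace_curv X Y :
  tr (fun U V => curv g nabla U X Y V) = - (e q * (m%:R - 1) * g X Y q).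
Proof.
have := ricci_curv_dev0 X Y.
have -> : ric X Y = tr (fun U V => curv g nabla U X Y V) +
    e q * (g X Y q * tr g - tr (fun U V => g X U * g V Y)).
  rewrite /tr /trace_at !mulr_sumr -sumrB mulr_sumr -big_split.
  apply: eq_bigr => i _; rewrite /W /curv_dev.
  change (g (E i) (E i) q * (curv g nabla (E i) X Y (E i) q +
      e q * (g X Y q * g (E i) (E i) q - g (E i) Y q * g X (E i) q)) =
    g (E i) (E i) q * curv g nabla (E i) X Y (E i) q +
      e q * (g X Y q * (g (E i) (E i) q * g (E i) (E i) q) -
             g (E i) (E i) q * (g X (E i) q * g (E i) Y q))).
  ring.
rewrite /tr (trace_at_metric oE) (trace_at_dim oE) => H.
apply: (eq_by_sub H); ring.
Qed.

End ricci.

(** * Mixed 3-Sasakian manifolds *)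

Section mixed.
Context {R : realType} {m : nat} {M : smoothManifold R m}.
Context (g : metric M) (eps : 'I_3 -> int) (S : 'I_3 -> structure M).
Context (mix : mixed_3_sasakian g eps S).

Lemma mixed_para0 : paraSasakian g (eps 0) (S 0).
Proof. by have [_ /(_ 0)] := mix. Qed.
Lemma mixed_para1 : paraSasakian g (eps 1) (S 1).
Proof. by have [_ /(_ 1)] := mix. Qed.

Lemma mixed_anticomm X : phi (S 1) (phi (S 0) X) =
  - phi (S 0) (phi (S 1) X) - eta (S 1) X *: xi (S 0) - eta (S 0) X *: xi (S 1).
Proof.
have [[[_ /(_ 0)]]] := mix.
have -> : ordS (0 : 'I_3) = 1 by apply/val_inj.
cbv zeta; have -> : ordS (1 : 'I_3) = ord_max by apply/val_inj.
move=> [H1 H2 _ _ _] _ _.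
have := H1 X; rewrite H2 /tau /= !mulrN1z opprK => E.
have -> : phi (S 0) (phi (S 1) X) =
    - phi (S 1) (phi (S 0) X) - eta (S 0) X *: xi (S 1)
    - eta (S 1) X *: xi (S 0).
  by rewrite -E addrK.
by rewrite !opprD !opprK !addrK.
Qed.

(** Both [phi_0 xi_1] and [phi_1 xi_0] are [xi_2] up to sign, and [xi_0] and
    [xi_1] are orthogonal, so [g xi_2 xi_2] is both [- eps_0] and [- eps_1].
    *)
Lemma mixed_eps : (eps 0)%:~R = (eps 1)%:~R :> smoothFun M.
Proof.
have [[[_ H] _] _] := mix.
have s01 : ordS (0 : 'I_3) = 1 by apply/val_inj.
have s12 : ordS (1 : 'I_3) = ord_max by apply/val_inj.
have s20 : ordS (ord_max : 'I_3) = 0 by apply/val_inj.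
have := H 0; rewrite s01; cbv zeta; rewrite s12 => -[_ _ _ _ [p01 p10]].
have := H 1; rewrite s12; cbv zeta; rewrite s20 => -[_ _ _ _ [p12 _]].
have := H ord_max; rewrite s20; cbv zeta; rewrite s01 => -[_ _ _ _ [_ p02]].
rewrite /tau /= ?mulr1z ?mulrN1z ?opprK in p01 p10 p12 p02.
have e10 : eta (S 1) (xi (S 0)) = 0 by rewrite -p12 (eta_phi mixed_para1).
have e01 : eta (S 0) (xi (S 1)) = 0.
  have := eta_phi mixed_para0 (xi (S ord_max)).
  by rewrite p02 linearN => /eqP; rewrite oppr_eq0 => /eqP.
have := metric_phi_phi mixed_para0 (xi (S 1)) (xi (S 1)).
rewrite p01 e01 !metricE (metric_xi_xi mixed_para1) !mul0r mulr0 sub0r.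
have := metric_phi_phi mixed_para1 (xi (S 0)) (xi (S 0)).
rewrite p10 e10 (metric_xi_xi mixed_para0) !mul0r mulr0 sub0r.
by rewrite ?opprK => -> /oppr_inj.
Qed.

End mixed.

Theorem theorem4p1 (R : realType) (n : nat) (M : smoothManifold R (4 * n + 3))
    (g : metric M) (eps : 'I_3 -> int) (S : 'I_3 -> structure M)
    (nabla : vfield M -> vfield M -> vfield M)
    (rho : vfield M -> vfield M -> smoothFun M)
    (S_sasakian : mixed_3_sasakian g eps S)
    (nabla_lc : levi_civita g nabla)
    (rho_ricci : is_ricci g nabla rho) :
  einstein g rho /\
  forall sigma : R,
    (positive eps /\ sigma = 1) \/ (negative eps /\ sigma = -1) ->
    forall X Y : vfield M,
      rho X Y = (- sigma * (4 * n + 2)%:R) *: g X Y.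
Proof.
suff main X Y : rho X Y = (- (eps 0)%:~R * (4 * n + 2)%:R) *: g X Y.
  split=> [|sigma]; first by exists (- (eps 0)%:~R * (4 * n + 2)%:R).
  by case=> -[[e0 _] ->] X Y; rewrite main e0.
apply/val_inj/funext => q.
have [E oE rhoE] := rho_ricci q.
apply: etrans (rhoE X Y) _.
have := (trace_curv nabla_lc (mixed_para0 S_sasakian) (mixed_para1 S_sasakian)
  (mixed_eps S_sasakian) (mixed_anticomm S_sasakian) oE X Y).
rewrite /trace_at /curv => ->.
have -> : ((eps 0)%:~R : smoothFun M) q = (eps 0)%:~R.
  exact: (rmorph_int (eval_at q)).
apply: (etrans (y := (- (eps 0)%:~R * (4 * n + 2)%:R) * (g X Y q))) => //.
rewrite !natrD; ring.
Qed.
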